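(* Let $N_1,N_2$ be norms in $\mathbb{R}^n$ with $N_i\in C^1(\mathbb{R}^n\setminus\{0\})$ and such that the unit spheres $\Sigma_i=\{x\in\mathbb{R}^n:N_i(x)=1\}$ are strictly convex, $i=1,2$, and let $p_i=\nabla N_i$ on $\mathbb{R}^n\setminus\{0\}$. Let $\Pi\subset\mathbb{R}^n$ be a hyperplane with unit normal $\nu$, and let $I$ and $II$ be the two open half-spaces determined by $\Pi$, with $\nu$ pointing from $I$ to $II$. Let $X\in I$, $Y\in II$, $P_0\in\Pi$, and set $$x=\frac{P_0-X}{N_1(P_0-X)}\in\Sigma_1,\qquad m=\frac{Y-P_0}{N_2(Y-P_0)}\in\Sigma_2 .$$ Then the following are equivalent: (i) (Fermat's principle) $P_0$ is the unique point of $\Pi$ such that $$\min\{N_1(P-X)+N_2(Y-P):P\in\Pi\}=N_1(P_0-X)+N_2(Y-P_0);$$ (ii) (Snell's law) $p_2(m)-p_1(x)\parallel\nu$.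
   Context: A unit sphere $\Sigma$ of a norm is called strictly convex if it contains no nondegenerate line segment. For a vector $v\in\mathbb{R}^n$, the notation $v\parallel\nu$ means that $v=\lambda\nu$ for some $\lambda\in\mathbb{R}$ (the case $\lambda=0$ is allowed). *)

(* Defs.v *)
From HB Require Import structures.
From mathcomp Require Import all_boot all_order all_algebra.
From mathcomp Require Import boolp classical_sets set_interval reals topology.
From mathcomp Require Import normedtype derive.

Set Implicit Arguments.
Unset Strict Implicit.
Unset Printing Implicit Defensive.

Import Order.TTheory GRing.Theory Num.Theory.
Import numFieldNormedType.Exports.

Local Open Scope classical_set_scope.
Local Open Scope ring_scope.

(* R^n is 'rV[R]_n; its library topology (from the sup norm) is the usual one. *)

Section Definitions.
Context {R : realType} {n : nat}.
Implicit Types (N f : 'rV[R]_n -> R) (u v nu a b x : 'rV[R]_n).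

(* The axioms of the factory Lmodule_isNormed, as a predicate: two different
   norms on the same space are needed. Nonnegativity follows from them. *)
Record is_norm N : Prop := IsNorm {
  is_norm_triangle : forall u v, N (u + v) <= N u + N v;
  is_norm_scale : forall (l : R) v, N (l *: v) = `|l| * N v;
  is_norm_eq0 : forall v, N v = 0 -> v = 0
}.

Definition unit_sphere N : set 'rV[R]_n := [set x | N x = 1].

Definition segment_set a b : set 'rV[R]_n :=
  [set (1 - t) *: a + t *: b | t in `[0, 1]].

Definition strictly_convex_sphere (S : set 'rV[R]_n) : Prop :=
  forall a b, a != b -> ~ (segment_set a b `<=` S).

Definition grad f x : 'rV[R]_n := \row_(i < n) 'D_(delta_mx 0 i) f x.

(* Intended for open U, where continuity of grad f on U is continuity at each
   of its points. *)
Definition C1_on (U : set 'rV[R]_n) f : Prop :=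
  forall x, U x -> differentiable f x /\ {for x, continuous (grad f)}.

Definition dotv u v : R := \sum_(i < n) u 0 i * v 0 i.

Definition euclidean_norm v : R := Num.sqrt (dotv v v).

(* The hyperplane with normal nu at level c; nu points from the half-space
   "below" it to the half-space "above" it. *)
Definition hyperplane nu (c : R) : set 'rV[R]_n := [set P | dotv P nu = c].
Definition open_half_below nu (c : R) : set 'rV[R]_n := [set P | dotv P nu < c].
Definition open_half_above nu (c : R) : set 'rV[R]_n := [set P | c < dotv P nu].

Definition parallel v nu : Prop := exists l : R, v = l *: nu.

Definition is_minimum (E : set R) (v : R) : Prop := E v /\ lbound E v.

End Definitions.

(* Main.v *)
Require Import Defs.
From HB Require Import structures.
From mathcomp Require Import all_boot all_order all_algebra.
From mathcomp Require Import boolp classical_sets set_interval functions reals topology.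
From mathcomp Require Import normedtype derive.
From mathcomp Require Import ring lra.

Set Implicit Arguments.
Unset Strict Implicit.
Unset Printing Implicit Defensive.

Import Order.TTheory GRing.Theory Num.Theory.
Import numFieldNormedType.Exports.

Local Open Scope classical_set_scope.
Local Open Scope ring_scope.

(** The travel time T(P) = N1(P - X) + N2(Y - P) is convex, so a point of the
    hyperplane minimizes T on it exactly when the derivative of T there
    vanishes in all tangent directions. Since the gradient of a norm is constant
    along open rays ([dotv_grad_scale]), that derivative in a direction h is
    (p1(x) - p2(m)) . h, and it vanishes for all h orthogonal to nu exactly when
    p2(m) - p1(x) is a multiple of nu ([parallelP]). This gives Snell's law at a
    minimizer; for the converse, the supporting-hyperplane inequality
    ([grad_norm_support]) for both norms bounds T below by T(P0).

    For uniqueness, let P be a second minimizer. At the midpoint of P0 and P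
    both norms are at most the average of their end values, and T is minimal,
    so N1 is additive on the pair P0 - X, P - X. By strict convexity these
    vectors lie on one ray ([strictly_convex_norm_add]), and a ray from X
    meets the hyperplane only once. *)

Section DotProduct.
Context {R : realType} {n : nat}.
Implicit Types (u v w nu : 'rV[R]_n) (l : R).

Lemma dotvC u v : dotv u v = dotv v u.
Proof. by apply: eq_bigr => i _; rewrite mulrC. Qed.

Lemma dotvDl u v w : dotv (u + v) w = dotv u w + dotv v w.
Proof. by rewrite -big_split; apply: eq_bigr => i _; rewrite mxE mulrDl. Qed.

Lemma dotvZl l u w : dotv (l *: u) w = l * dotv u w.
Proof. by rewrite mulr_sumr; apply: eq_bigr => i _; rewrite mxE mulrA. Qed.

Lemma dotvNl u w : dotv (- u) w = - dotv u w.
Proof. by rewrite -scaleN1r dotvZl mulN1r. Qed.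

Lemma dotvBl u v w : dotv (u - v) w = dotv u w - dotv v w.
Proof. by rewrite dotvDl dotvNl. Qed.

Lemma dotvZr l u w : dotv w (l *: u) = l * dotv w u.
Proof. by rewrite dotvC dotvZl dotvC. Qed.

Lemma dotvNr u w : dotv w (- u) = - dotv w u.
Proof. by rewrite dotvC dotvNl dotvC. Qed.

Lemma dotv_ge0 u : 0 <= dotv u u.
Proof. by apply: sumr_ge0 => i _; rewrite -expr2 sqr_ge0. Qed.

Lemma dotv_eq0 u : dotv u u = 0 -> u = 0.
Proof.
move=> /eqP; rewrite psumr_eq0 => [/allP u0|i _]; last by rewrite -expr2 sqr_ge0.
apply/rowP => i; rewrite mxE; apply/eqP.
by have := u0 i (mem_index_enum i); rewrite /= mulf_eq0 orbb.
Qed.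

Lemma dotv_unit nu : euclidean_norm nu = 1 -> dotv nu nu = 1.
Proof. by move=> h; rewrite -(sqr_sqrtr (dotv_ge0 nu)) -/(euclidean_norm nu) h expr1n. Qed.

(** The component of v orthogonal to nu is itself a test vector h, and
    orthogonality to it says that its squared length is zero. *)
Lemma parallelP v nu : euclidean_norm nu = 1 ->
  parallel v nu <-> (forall h, dotv h nu = 0 -> dotv v h = 0).
Proof.
move=> /dotv_unit nu1; split=> [[l ->] h hnu|v_tangent].
  by rewrite dotvZl dotvC hnu mulr0.
exists (dotv v nu); apply/eqP; rewrite -subr_eq0; apply/eqP; apply: dotv_eq0.
set h := v - _; have hnu : dotv h nu = 0 by rewrite dotvBl dotvZl nu1 mulr1 subrr.
by rewrite {1}/h dotvBl dotvZl (dotvC nu) hnu v_tangent // mulr0 subr0.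
Qed.

End DotProduct.

(** * Directional derivatives *)

Section DirectionalDerivative.
Context {R : realType} {n : nat}.
Implicit Types (f : 'rV[R]_n -> R) (a v y : 'rV[R]_n) (s q : R).

Lemma derive_dotv_grad f a v :
  differentiable f a -> 'D_v f a = dotv (grad f a) v.
Proof.
move=> df; rewrite deriveE // {1}(row_sum_delta v) linear_sum.
by apply: eq_bigr => i _; rewrite linearZ /= mxE deriveE // mulrC.
Qed.

Section AffineArgument.
Variables (f : 'rV[R]_n -> R) (s : R) (y a v : 'rV[R]_n).

Let affine_increments : (fun h : R =>
    h^-1 *: (((fun P => f (s *: P + y)) \o shift a) (h *: v) - f (s *: a + y))) =
  (fun h => h^-1 *: ((f \o shift (s *: a + y)) (h *: (s *: v)) - f (s *: a + y))).
Proof.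
apply/funext => h /=; congr (_ *: (f _ - _)).
by rewrite scalerDr addrA !scalerA [s * h]mulrC.
Qed.

(** The difference quotients of both sides are the same function. It
    covers translations, reflections and dilations of the argument of f. *)
Lemma derive_affine :
  'D_v (fun P => f (s *: P + y)) a = 'D_(s *: v) f (s *: a + y).
Proof. by rewrite /derive affine_increments. Qed.

Lemma derivable_affine :
  derivable f (s *: a + y) (s *: v) -> derivable (fun P => f (s *: P + y)) a v.
Proof. by rewrite /derivable affine_increments. Qed.

End AffineArgument.

Lemma derive_ge f a v q : derivable f a v ->
    (forall t : R, 0 < t -> t <= 1 -> t * q <= f (t *: v + a) - f a) ->
  q <= 'D_v f a.
Proof.
move=> /cvg_dnbhs_at_right dfa f_ge.
apply: (cvgr_to_ge dfa); near=> t.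
have t0 : 0 < t by near: t; exact: nbhs_right_gt.
have t1 : t <= 1 by near: t; exact: nbhs_right_le.
by rewrite /= /GRing.scale /= mulrC ler_pdivlMr // mulrC f_ge.
Unshelve. all: by end_near. Qed.

End DirectionalDerivative.

(** * Norms and their gradients *)

Section Norm.
Context {R : realType} {n : nat}.
Variables (N : 'rV[R]_n -> R) (N_norm : is_norm N).
Implicit Types (a b u v w h : 'rV[R]_n) (l s t : R).

Lemma norm0 : N 0 = 0.
Proof. by have := is_norm_scale N_norm 0 0; rewrite scale0r normr0 mul0r. Qed.

Lemma normN v : N (- v) = N v.
Proof. by rewrite -scaleN1r (is_norm_scale N_norm) normrN1 mul1r. Qed.

Lemma normZ_ge0 l v : 0 <= l -> N (l *: v) = l * N v.
Proof. by move=> l0; rewrite (is_norm_scale N_norm) ger0_norm. Qed.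

Lemma norm_gt0 v : v != 0 -> 0 < N v.
Proof.
move=> v0; rewrite lt_neqAle; apply/andP; split.
  by apply: contraNneq v0 => /esym/(is_norm_eq0 N_norm) ->.
by have := is_norm_triangle N_norm v (- v); rewrite subrr norm0 normN; lra.
Qed.

(** The derivative of a convex function at a is at most each of its secant
    slopes from a; the secant from a to w bounds dN(a)(w - a). *)
Lemma grad_norm_support a w : differentiable N a ->
  N a + dotv (grad N a) (w - a) <= N w.
Proof.
move=> dNa; rewrite -derive_dotv_grad //.
have dN : derivable N a (w - a) by exact: diff_derivable.
suff : - (N w - N a) <= 'D_(w - a) (- N) a by rewrite deriveN //; lra.
apply: derive_ge => [|t t0 t1]; first exact: derivableN.
have -> : t *: (w - a) + a = t *: w + (1 - t) *: a.
  by rewrite scalerBr scalerBl scale1r -addrA [- _ + a]addrC.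
have := is_norm_triangle N_norm (t *: w) ((1 - t) *: a).
rewrite !normZ_ge0 ?subr_ge0 //; last exact: ltW.
rewrite -[(- N) _]/(- N _) -[(- N) a]/(- N a); lra.
Qed.

(** Homogeneity: the increments of N at l a along l h are l times those at a
    along h. *)
Lemma dotv_grad_scale l a h : 0 < l ->
  differentiable N a -> differentiable N (l *: a) ->
  dotv (grad N (l *: a)) h = dotv (grad N a) h.
Proof.
move=> l0 dNa dNla.
have NlE : (fun P => N (l *: P + 0)) = l \*: N.
  by apply/funext => P /=; rewrite addr0 normZ_ge0 // ltW.
have := derive_affine N l 0 a h; rewrite addr0 NlE.
rewrite deriveZ; last exact: diff_derivable.
rewrite !derive_dotv_grad // dotvZr => /(mulfI _) -> //.
by rewrite gt_eqF.
Qed.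

(** If N (a + b) = N a + N b then N is linear on the cone spanned by a and b:
    for s <= t, writing t (a + b) = (s a + t b) + (t - s) a makes the triangle
    inequality bound N (s a + t b) below. *)
Lemma norm_add_cone a b s t : N (a + b) = N a + N b -> 0 <= s -> 0 <= t ->
  N (s *: a + t *: b) = s * N a + t * N b.
Proof.
wlog le_st : a b s t / s <= t.
  move=> wl Nab s0 t0; case: (leP s t) => [st|/ltW ts]; first exact: wl.
  by rewrite addrC wl // 1?addrC // Nab addrC.
move=> Nab s0 t0; apply/eqP; rewrite eq_le; apply/andP; split.
  by rewrite -!normZ_ge0 // is_norm_triangle.
have := is_norm_triangle N_norm (s *: a + t *: b) ((t - s) *: a).
have -> : s *: a + t *: b + (t - s) *: a = t *: (a + b).
  by rewrite addrAC -scalerDl [s + _]addrC subrK -scalerDr.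
by rewrite !normZ_ge0 ?subr_ge0 // Nab; lra.
Qed.

(** Otherwise the segment between the two normalized vectors would lie in
    the unit sphere. *)
Lemma strictly_convex_norm_add a b :
  strictly_convex_sphere (unit_sphere N) -> a != 0 -> b != 0 ->
  N (a + b) = N a + N b -> (N a)^-1 *: a = (N b)^-1 *: b.
Proof.
move=> N_convex /norm_gt0 a0 /norm_gt0 b0 Nab.
apply/eqP/negPn/negP => /N_convex; apply => _ [t /= + <-].
rewrite in_itv /= => /andP[t0 t1].
rewrite /unit_sphere /= !scalerA norm_add_cone //.
- by rewrite -!mulrA !mulVf ?gt_eqF // !mulr1 subrK.
- by rewrite mulr_ge0 ?subr_ge0 // invr_ge0 ltW.
- by rewrite mulr_ge0 // invr_ge0 ltW.
Qed.

End Norm.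

(** * Minimizers of the travel time *)

Section Refraction.
Context {R : realType} {n : nat}.
Variables (N1 N2 : 'rV[R]_n -> R).
Hypotheses (N1_norm : is_norm N1) (N2_norm : is_norm N2).
Variables (nu X Y P0 : 'rV[R]_n) (c : R).
Let T P := N1 (P - X) + N2 (Y - P).

Lemma stationary_of_minimizer h :
  differentiable N1 (P0 - X) -> differentiable N2 (Y - P0) ->
  hyperplane nu c P0 -> (forall Q, hyperplane nu c Q -> T P0 <= T Q) ->
  dotv h nu = 0 ->
  dotv (grad N1 (P0 - X)) h = dotv (grad N2 (Y - P0)) h.
Proof.
move=> d1 d2 P0_Pi P0_min.
have E1 : (fun P => N1 (1 *: P + - X)) = (fun P => N1 (P - X)).
  by apply/funext => P; rewrite scale1r.
have E2 : (fun P => N2 (-1 *: P + Y)) = (fun P => N2 (Y - P)).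
  by apply/funext => P; rewrite scaleN1r addrC.
have D1 k : 'D_k (fun P => N1 (P - X)) P0 = dotv (grad N1 (P0 - X)) k.
  by rewrite -E1 derive_affine !scale1r derive_dotv_grad.
have D2 k : 'D_k (fun P => N2 (Y - P)) P0 = - dotv (grad N2 (Y - P0)) k.
  by rewrite -E2 derive_affine !scaleN1r addrC derive_dotv_grad // dotvNr.
have d1' k : derivable (fun P => N1 (P - X)) P0 k.
  by rewrite -E1; apply: derivable_affine; rewrite !scale1r; exact: diff_derivable.
have d2' k : derivable (fun P => N2 (Y - P)) P0 k.
  rewrite -E2; apply: derivable_affine; rewrite !scaleN1r addrC.
  exact: diff_derivable.
(* The one-sided bound for k = h and for k = - h. *)
have slope_ge0 k : dotv k nu = 0 ->
    0 <= dotv (grad N1 (P0 - X)) k - dotv (grad N2 (Y - P0)) k.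
  move=> knu; rewrite -D1 -D2 -deriveD //.
  apply: derive_ge => [|t _ _]; first exact: derivableD.
  rewrite mulr0 subr_ge0; apply: P0_min.
  by rewrite /hyperplane /= dotvDl dotvZl knu mulr0 add0r.
move=> hnu; have := slope_ge0 h hnu; have := slope_ge0 (- h).
by rewrite dotvNl hnu oppr0 !dotvNr => /(_ erefl); lra.
Qed.

Lemma minimizer_of_stationary Q :
  differentiable N1 (P0 - X) -> differentiable N2 (Y - P0) ->
  dotv (grad N1 (P0 - X)) (Q - P0) = dotv (grad N2 (Y - P0)) (Q - P0) ->
  T P0 <= T Q.
Proof.
move=> d1 d2 stat.
have := grad_norm_support N1_norm (Q - X) d1.
have := grad_norm_support N2_norm (Y - Q) d2.
have -> : Q - X - (P0 - X) = Q - P0 by rewrite opprB addrA subrK.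
have -> : Y - Q - (Y - P0) = - (Q - P0).
  by rewrite opprB opprB addrC addrA subrK.
by rewrite dotvNr stat /T; lra.
Qed.

Lemma minimizer_unique P :
  strictly_convex_sphere (unit_sphere N1) -> open_half_below nu c X ->
  hyperplane nu c P0 -> hyperplane nu c P ->
  (forall Q, hyperplane nu c Q -> T P0 <= T Q) ->
  (forall Q, hyperplane nu c Q -> T P <= T Q) -> P0 = P.
Proof.
rewrite /hyperplane /open_half_below /= => N1_convex Xc P0c Pc P0_min P_min.
have off Q : dotv Q nu = c -> dotv (Q - X) nu != 0 /\ Q - X != 0.
  move=> Qc; have dQ : dotv (Q - X) nu != 0.
    by rewrite dotvBl Qc subr_eq0 gt_eqF.
  split=> //; apply: contraNneq dQ => ->.
  by rewrite -(scale0r (0 : 'rV[R]_n)) dotvZl mul0r.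
have [dP0 aN0] := off _ P0c; have [dP bN0] := off _ Pc.
pose M := 2^-1 *: (P0 + P).
have half2 (v : 'rV[R]_n) : 2^-1 *: (v + v) = v.
  by rewrite -mulr2n -(scaler_nat 2 v) scalerA mulVf ?pnatr_eq0 // scale1r.
have Mc : dotv M nu = c by rewrite dotvZl dotvDl P0c Pc; field.
have N1M : N1 (M - X) = 2^-1 * N1 ((P0 - X) + (P - X)).
  by rewrite -normZ_ge0 // ?invr_ge0 // addrACA -opprD scalerBr half2.
have N2M : N2 (Y - M) = 2^-1 * N2 ((Y - P0) + (Y - P)).
  by rewrite -normZ_ge0 // ?invr_ge0 // addrACA -opprD scalerBr half2.
have N1_add : N1 ((P0 - X) + (P - X)) = N1 (P0 - X) + N1 (P - X).
  have := P0_min _ Mc; have := P_min _ Mc; rewrite /T N1M N2M.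
  have := is_norm_triangle N1_norm (P0 - X) (P - X).
  have := is_norm_triangle N2_norm (Y - P0) (Y - P).
  by lra.
have ray := strictly_convex_norm_add N1_norm N1_convex aN0 bN0 N1_add.
(* Both vectors have the same nu-component, so their norms agree too. *)
have inv_eq : (N1 (P0 - X))^-1 = (N1 (P - X))^-1.
  apply: (mulIf dP0); rewrite -dotvZl ray dotvZl; congr (_ * _).
  by rewrite !dotvBl P0c Pc.
move: ray; rewrite inv_eq => /scalerI ray; apply: (addIr (- X)); apply: ray.
by rewrite invr_eq0 gt_eqF // norm_gt0.
Qed.

End Refraction.

Theorem mainTheorem1 (R : realType) (n : nat) (N1 N2 : 'rV[R]_n -> R)
    (N1_norm : is_norm N1) (N2_norm : is_norm N2)
    (N1_C1 : C1_on (~` [set 0]) N1) (N2_C1 : C1_on (~` [set 0]) N2)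
    (S1_convex : strictly_convex_sphere (unit_sphere N1))
    (S2_convex : strictly_convex_sphere (unit_sphere N2))
    (nu : 'rV[R]_n) (c : R) (nu_unit : euclidean_norm nu = 1)
    (X Y P0 : 'rV[R]_n)
    (X_I : open_half_below nu c X) (Y_II : open_half_above nu c Y)
    (P0_Pi : hyperplane nu c P0) :
  let p1 := grad N1 in
  let p2 := grad N2 in
  let x := (N1 (P0 - X))^-1 *: (P0 - X) in
  let m := (N2 (Y - P0))^-1 *: (Y - P0) in
  let travel_time (P : 'rV[R]_n) := N1 (P - X) + N2 (Y - P) in
  unique (fun P => hyperplane nu c P /\
      is_minimum [set travel_time Q | Q in hyperplane nu c] (travel_time P)) P0
  <-> parallel (p2 m - p1 x) nu.
Proof.
move=> p1 p2 x m T.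
have minP P : hyperplane nu c P ->
    is_minimum [set T Q | Q in hyperplane nu c] (T P) <->
    (forall Q, hyperplane nu c Q -> T P <= T Q).
  move=> PPi; split=> [[_ lbP] Q QPi|Pmin]; first by apply: lbP; exists Q.
  by split; [exists P | move=> _ [Q QPi <-]; exact: Pmin].
have a0 : P0 - X != 0.
  rewrite subr_eq0; apply: contraPneq X_I => <-.
  by rewrite /open_half_below /= P0_Pi ltxx.
have b0 : Y - P0 != 0.
  rewrite subr_eq0; apply: contraPneq Y_II => ->.
  by rewrite /open_half_above /= P0_Pi ltxx.
have diff1 v : v != 0 -> differentiable N1 v by move=> /eqP /N1_C1[].
have diff2 v : v != 0 -> differentiable N2 v by move=> /eqP /N2_C1[].
have [d1 d2] := (diff1 _ a0, diff2 _ b0).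
have Na : 0 < (N1 (P0 - X))^-1 by rewrite invr_gt0 norm_gt0.
have Nb : 0 < (N2 (Y - P0))^-1 by rewrite invr_gt0 norm_gt0.
have p1x h : dotv (p1 x) h = dotv (grad N1 (P0 - X)) h.
  by apply: dotv_grad_scale => //; apply: diff1; rewrite scaler_eq0 gt_eqF.
have p2m h : dotv (p2 m) h = dotv (grad N2 (Y - P0)) h.
  by apply: dotv_grad_scale => //; apply: diff2; rewrite scaler_eq0 gt_eqF.
rewrite parallelP //; split=> [[[_ P0min] _] h hnu|snell].
  rewrite dotvBl p1x p2m (stationary_of_minimizer d1 d2 P0_Pi _ hnu) ?subrr //.
  exact/minP.
have P0min Q : hyperplane nu c Q -> T P0 <= T Q.
  move=> QPi; apply: minimizer_of_stationary => //; apply/esym/eqP.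
  by rewrite -p1x -p2m -subr_eq0 -dotvBl snell // dotvBl QPi P0_Pi subrr.
split=> [|P [PPi /(minP _ PPi) Pmin]]; first by split=> //; exact/minP.
exact: (minimizer_unique N1_norm N2_norm S1_convex X_I P0_Pi PPi P0min Pmin).
Qed.
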